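(* Consider the sub-problem, i.e. the single-user Markov decision process described in the context, in which the arrivals are i.i.d. Bernoulli with $P[\Lambda(t)=1]=p$ (where $p>0$, so that $1/p$ makes sense; $p=1$ is allowed). The Whittle index of the sub-problem for the state $(x,\lambda)$, with $x\in\{1,2,\dots\}$ and $\lambda\in\{0,1\}$, is $$I(x,\lambda)=\begin{cases}0 & \text{if }\lambda=0,\\[2pt] \frac{x^2}{2}-\frac{x}{2}+\frac{x}{p} & \text{if }\lambda=1.\end{cases}$$
   Context: Sub-problem: a single-user Markov decision process with updating cost $C\in\mathbb{R}$, in discrete time $t=0,1,2,\dots$. States: $\mathbf{s}(t)=(X(t),\Lambda(t))$ with age $X(t)\in\{1,2,\dots\}$ and arrival indicator $\Lambda(t)\in\{0,1\}$. Actions: $a(t)\in\{0,1\}$, where $1$ means ''update'' and $0$ means ''idle''; both actions are available in every state. Transitions: from state $(x,\lambda)$ under action $a$, the next age is $1$ if $a=\lambda=1$ and is $x+1$ otherwise; independently of the past, the next arrival indicator is $1$ with probability $p$ and $0$ with probability $1-p$. Immediate cost: $C\bigl((x,\lambda),a\bigr)=(x+1-x\,a\,\lambda)+C\,a$. Policies: a policy $\mu=\{a(0),a(1),\dots\}$ specifies an action for each slot; it may be history dependent and randomized. The objective is to minimize, over policies, the average cost $\limsup_{T\to\infty}\frac{1}{T+1}E_\mu\left[\sum_{t=0}^{T}C(\mathbf{s}(t),a(t))\right]$. Threshold-type policy with threshold $\bar X\in\{1,2,\dots\}$: the stationary deterministic policy that idles in every state $(x,0)$, and in state $(x,1)$ updates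 if $x\ge\bar X$ and idles if $x<\bar X$. (For $C\ge 0$ some policy of this type minimizes the average cost among all policies.) Whittle index: the Whittle index $I(\mathbf{s})$ of a state $\mathbf{s}$ is the cost $C$ that makes both actions for state $\mathbf{s}$ equally desirable. This is understood as follows. For a state $(x,0)$, both actions lead to the same next age and the same law of the next arrival indicator, so they are equally desirable when they have the same immediate cost. For a state $(x,1)$, the two actions are equally desirable when the thresholds $x$ and $x+1$ have equal average cost and both minimize the average cost over all thresholds $\bar X\in\{1,2,\dots\}$. *)

(* Defs.v *)
From HB Require Import structures.
From mathcomp Require Import all_boot all_order all_algebra.
From mathcomp Require Import all_classical all_reals all_analysis.

Set Implicit Arguments.
Unset Strict Implicit.
Unset Printing Implicit Defensive.

Import Order.TTheory GRing.Theory Num.Theory.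
Import numFieldNormedType.Exports.

Local Open Scope ring_scope.

(* (x, lam): age and arrival indicator.  Ages are meant to be at least 1; the
   dynamics preserve this, so positivity is only imposed on initial states. *)
Definition state : Type := (nat * bool)%type.

(* true = update, false = idle *)
Definition action : Type := bool.

Definition next_age (s : state) (a : action) : nat :=
  if a && s.2 then 1%N else s.1.+1.

Definition cost (R : realType) (C : R) (s : state) (a : action) : R :=
  (s.1%:R + 1 - s.1%:R * a%:R * s.2%:R) + C * a%:R.

(* A history-dependent randomized policy: [mu h s] is the probability of
   updating in state [s] after the past state-action pairs [h], oldest first. *)
Record policy (R : realType) := Policy {
  update_prob :> seq (state * action) -> state -> R ;
  update_probP : forall h s, 0 <= update_prob h s <= 1 }.

(* An outcome [:: (a(0), Lambda(1)); (a(1), Lambda(2)); ...] determines, from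
   the initial state, the visited state-action pairs. *)
Fixpoint trajectory (s : state) (w : seq (action * bool)) :
    seq (state * action) :=
  if w is (a, l) :: w' then (s, a) :: trajectory (next_age s a, l) w' else [::].

(* Probability of the outcome [w] from [s] with past [h]: actions are drawn from
   the policy, arrivals are Bernoulli(p) independently of the past. *)
Fixpoint outcome_prob (R : realType) (p : R) (mu : policy R)
    (h : seq (state * action)) (s : state) (w : seq (action * bool)) : R :=
  if w is (a, l) :: w' then
    bernoulli_pmf (mu h s) a * bernoulli_pmf p l *
      outcome_prob p mu (rcons h (s, a)) (next_age s a, l) w'
  else 1.

(* E_mu[ sum_(t = 0)^T C(s(t), a(t)) | s(0) = s0 ]; outcomes of length T + 1 also
   record Lambda(T + 1), which does not affect the cost. *)
Definition expected_cost (R : realType) (p C : R) (s0 : state) (mu : policy R)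
    (T : nat) : R :=
  \sum_(w : T.+1.-tuple (action * bool)%type)
    outcome_prob p mu [::] s0 w *
    \sum_(sa <- trajectory s0 w) cost C sa.1 sa.2.

Definition average_cost (R : realType) (p C : R) (s0 : state) (mu : policy R) :
    \bar R :=
  limn_esup (fun T => (expected_cost p C s0 mu T / T.+1%:R)%:E).

Definition threshold_prob (R : realType) (Xbar : nat)
    (h : seq (state * action)) (s : state) : R :=
  (s.2 && (Xbar <= s.1)%N)%:R.

Lemma threshold_probP (R : realType) (Xbar : nat) h s :
  0 <= threshold_prob R Xbar h s <= 1.
Proof. by rewrite /threshold_prob ler0n lern1 leq_b1. Qed.

Definition threshold_policy (R : realType) (Xbar : nat) : policy R :=
  Policy (@threshold_probP R Xbar).

Definition optimal_threshold (R : realType) (p C : R) (s0 : state)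
    (Xbar : nat) : Prop :=
  forall Y : nat, (0 < Y)%N ->
    (average_cost p C s0 (threshold_policy R Xbar) <=
     average_cost p C s0 (threshold_policy R Y))%E.

(* Without an arrival the two actions induce the same transition law, so only
   the immediate costs are compared. *)
Definition equally_desirable (R : realType) (p : R) (s0 : state) (C : R)
    (s : state) : Prop :=
  if s.2 then
    [/\ average_cost p C s0 (threshold_policy R s.1) =
        average_cost p C s0 (threshold_policy R s.1.+1),
        optimal_threshold p C s0 s.1 & optimal_threshold p C s0 s.1.+1]
  else cost C s true = cost C s false.

(* [c] is the one and only cost making both actions equally desirable in [s];
   [s0] is the initial state with respect to which average costs are taken. *)
Definition is_whittle_index (R : realType) (p : R) (s0 s : state) (c : R) :
    Prop :=
  forall C : R, equally_desirable p s0 C s <-> C = c.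

(* Main.v *)
Require Import Defs.
From mathcomp Require Import all_boot all_order all_algebra.
From mathcomp Require Import all_classical all_reals all_analysis.
From mathcomp Require Import ring lra.
Import Order.TTheory GRing.Theory Num.Theory.
Import numFieldNormedType.Exports.
Local Open Scope ring_scope.

(** For the threshold [M], an explicit function [v] solves the Poisson equation
    [v + g = cost + P v], where [P] is the transition kernel of the controlled
    chain and [g] the expected cost of a cycle divided by its expected length.
    Telescoping gives [E cost = (T + 1) g + v(s0) - (P^(T+1) v)(s0)].  As [v]
    grows at most linearly in the age, and only in states without arrival, a
    drift inequality bounds [P^n v] at [s0], so the average cost is [g(M)].
    When [C] is the claimed index of [(x, 1)], completing the square in [M]
    shows that [g(M) - (x + 1/p)] is a positive multiple of
    [(M - x) (M - x - 1)], which is nonnegative on integers and vanishes exactly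
    at [M = x] and [M = x + 1]. *)

Lemma big_tuple_cons (R : nmodType) (A : finType) (n : nat)
    (F : seq A -> R) :
  \sum_(w : n.+1.-tuple A) F w = \sum_(a : A) \sum_(w : n.-tuple A) F (a :: w).
Proof.
rewrite pair_big /=.
rewrite (reindex (fun q : A * n.-tuple A => [tuple of q.1 :: q.2])) //=.
exists (fun w : n.+1.-tuple A => (thead w, [tuple of behead w])) => w _ /=.
  by case: w => a w /=; congr pair; apply/val_inj.
by rewrite [RHS](tuple_eta w); apply/val_inj.
Qed.

Lemma big_action_arrival (R : nmodType) (F : action * bool -> R) :
  \sum_al F al = \sum_(a : bool) \sum_(l : bool) F (a, l).
Proof. by rewrite pair_big; apply: eq_bigr => -[]. Qed.

Lemma bernoulli_pmf_sum (R : numDomainType) (p : R) :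
  \sum_(b : bool) bernoulli_pmf p b = 1.
Proof. by rewrite big_bool /bernoulli_pmf /=; ring. Qed.

Lemma outcome_prob_sum (R : realType) (p : R) (mu : policy R) n h s :
  \sum_(w : n.-tuple (action * bool)%type) outcome_prob p mu h s w = 1.
Proof.
elim: n h s => [|n IH] h s.
  rewrite (big_pred1 [tuple]) //= => w.
  by apply/esym/eqP; exact: tuple0.
rewrite big_tuple_cons big_action_arrival /=.
under eq_bigr => a _.
  under eq_bigr => l _ do rewrite -mulr_sumr IH mulr1.
  rewrite -mulr_sumr bernoulli_pmf_sum mulr1; over.
exact: bernoulli_pmf_sum.
Qed.

Definition threshold_action (M : nat) (s : state) : action :=
  s.2 && (M <= s.1)%N.

Definition threshold_age (M : nat) (s : state) : nat :=
  next_age s (threshold_action M s).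

Definition arrival_mean {R : realType} (p : R) (f : state -> R) (x : nat) : R :=
  p * f (x, true) + (1 - p) * f (x, false).

Definition threshold_kernel {R : realType} (p : R) (M : nat) (f : state -> R) :
    state -> R :=
  fun s => arrival_mean p f (threshold_age M s).

Definition threshold_cost {R : realType} (C : R) (M : nat) (s : state) : R :=
  cost C s (threshold_action M s).

Lemma threshold_cost_rec (R : realType) (p C : R) (M n : nat) h s :
  let J n h s := \sum_(w : n.-tuple (action * bool)%type)
    outcome_prob p (threshold_policy R M) h s w *
    \sum_(sa <- trajectory s w) cost C sa.1 sa.2 in
  J n.+1 h s = threshold_cost C M s +
    arrival_mean p (J n (rcons h (s, threshold_action M s)))
      (threshold_age M s).
Proof.
move=> J.
rewrite {1}/J (big_tuple_cons _ _ _ (fun w =>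
  outcome_prob p (threshold_policy R M) h s w *
    \sum_(sa <- trajectory s w) cost C sa.1 sa.2)) big_action_arrival /=.
have split_first a l : \sum_(w : n.-tuple (action * bool)%type)
    bernoulli_pmf (threshold_prob R M h s) a * bernoulli_pmf p l *
    outcome_prob p (threshold_policy R M) (rcons h (s, a)) (next_age s a, l) w *
    \sum_(sa <- (s, a) :: trajectory (next_age s a, l) w) cost C sa.1 sa.2 =
  bernoulli_pmf (threshold_prob R M h s) a * bernoulli_pmf p l *
    (cost C s a + J n (rcons h (s, a)) (next_age s a, l)).
  under eq_bigr => w _ do rewrite big_cons /= -mulrA mulrDr.
  by rewrite -mulr_sumr big_split /= -mulr_suml outcome_prob_sum mul1r.
under eq_bigr => a _ do under eq_bigr => l _ do rewrite split_first.
rewrite !big_bool /bernoulli_pmf /threshold_prob.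
rewrite /threshold_cost /threshold_age /arrival_mean /threshold_action.
by case: (_ && _); rewrite /=; ring.
Qed.

Lemma expected_cost_poisson (R : realType) (p C g : R) (M : nat)
    (v : state -> R) s0 T :
  (forall s, v s + g = threshold_cost C M s + threshold_kernel p M v s) ->
  expected_cost p C s0 (threshold_policy R M) T =
    T.+1%:R * g + v s0 - iter T.+1 (threshold_kernel p M) v s0.
Proof.
move=> poisson; rewrite /expected_cost.
move: [::] => h; move: T.+1 => n {T}.
elim: n h s0 => [|n IH] h s.
  rewrite big1 => [|w _]; first by rewrite /=; ring.
  by rewrite (tuple0 w) big_nil mulr0.
rewrite threshold_cost_rec /arrival_mean !IH iterS.
have := poisson s; rewrite /threshold_kernel /arrival_mean -natr1.
set P := iter _ _ _; lra.
Qed.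

Lemma threshold_kernel_le (R : realType) (p : R) (M : nat) (f f' : state -> R) :
  0 < p -> p <= 1 ->
  (forall s, f s <= f' s) ->
  forall s, threshold_kernel p M f s <= threshold_kernel p M f' s.
Proof.
move=> p_gt0 p_le1 ff' s; rewrite /threshold_kernel /arrival_mean.
by apply: lerD; apply: ler_wpM2l => //; [exact: ltW | rewrite subr_ge0].
Qed.

Lemma iter_threshold_kernel_le (R : realType) (p : R) (M n : nat)
    (f f' : state -> R) :
  0 < p -> p <= 1 ->
  (forall s, f s <= f' s) -> forall s,
  iter n (threshold_kernel p M) f s <= iter n (threshold_kernel p M) f' s.
Proof.
by move=> p_gt0 p_le1 ff'; elim: n => [//|n IH]; exact: threshold_kernel_le.
Qed.

Lemma iter_threshold_kernel_affine (R : realType) (p : R) (M n : nat) (a b : R)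
    (f : state -> R) s :
  iter n (threshold_kernel p M) (fun s => a * f s + b) s =
  a * iter n (threshold_kernel p M) f s + b.
Proof.
elim: n s => [//|n IH] s.
rewrite !iterS /threshold_kernel /arrival_mean !IH; ring.
Qed.

Definition idle_age {R : realType} (s : state) : R := if s.2 then 0 else s.1%:R.

Lemma idle_age_ge0 (R : realType) s : 0 <= idle_age s :> R.
Proof. by rewrite /idle_age; case: s.2. Qed.

(* An arrival at age at least [M] resets the age, hence the contraction by
   [1 - p]; below [M] the loss is absorbed by the additive constant. *)
Lemma idle_age_drift (R : realType) (p : R) (M : nat) s :
  0 < p -> p <= 1 ->
  threshold_kernel p M idle_age s <= (1 - p) * idle_age s + M.+1%:R.
Proof.
move=> p_gt0 p_le1; have := ler0n R M; rewrite -natr1.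
rewrite /threshold_kernel /arrival_mean /threshold_age /threshold_action.
case: s => x [] /=; rewrite /idle_age /next_age /= -?natr1; last by nra.
case: leqP => [_|xM] /=; first by nra.
have := ler0n R x; move: xM; rewrite -(ltr_nat R) -?natr1 => xM; nra.
Qed.

Lemma iter_idle_age_bounded (R : realType) (p : R) (M n : nat) s :
  0 < p -> p <= 1 ->
  iter n (threshold_kernel p M) idle_age s <= idle_age s + M.+1%:R / p.
Proof.
move=> p_gt0 p_le1.
have Mp : M.+1%:R = p * (M.+1%:R / p) by rewrite mulrC divfK// gt_eqF.
have c_ge0 : 0 <= M.+1%:R / p by rewrite divr_ge0// ltW.
elim: n => [|n IH]; first by rewrite lerDl.
have drift s' := idle_age_drift _ p M s' p_gt0 p_le1.
rewrite iterSr.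
apply: le_trans (iter_threshold_kernel_le _ _ _ n _ _ p_gt0 p_le1 drift s) _.
rewrite iter_threshold_kernel_affine {1}Mp.
have := idle_age_ge0 R s; nra.
Qed.

Lemma iter_threshold_kernel_bounded (R : realType) (p : R) (M : nat)
    (v : state -> R) (A : R) s :
  0 < p -> p <= 1 ->
  (forall s, `|v s| <= A * idle_age s + A) ->
  exists B, forall n, `|iter n (threshold_kernel p M) v s| <= B.
Proof.
move=> p_gt0 p_le1 vA; have A_ge0 : 0 <= A.
  by have := le_trans (normr_ge0 _) (vA (0%N, true)); rewrite mulr0 add0r.
exists (A * (idle_age s + M.+1%:R / p) + A) => n.
have bnd := iter_idle_age_bounded _ p M n s p_gt0 p_le1.
have vleA s' : v s' <= A * idle_age s' + A := le_trans (ler_norm _) (vA s').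
have Alev s' : (- A) * idle_age s' + (- A) <= v s'.
  rewrite mulNr -opprD lerNl; apply: le_trans (vA s').
  by rewrite -normrN ler_norm.
have := iter_threshold_kernel_le _ p M n _ _ p_gt0 p_le1 vleA s.
have := iter_threshold_kernel_le _ p M n _ _ p_gt0 p_le1 Alev s.
rewrite !iter_threshold_kernel_affine ler_norml; nra.
Qed.

Lemma average_cost_poisson (R : realType) (p C g A : R) (M : nat)
    (v : state -> R) s0 :
  0 < p -> p <= 1 ->
  (forall s, v s + g = threshold_cost C M s + threshold_kernel p M v s) ->
  (forall s, `|v s| <= A * idle_age s + A) ->
  average_cost p C s0 (threshold_policy R M) = g%:E.
Proof.
move=> p0 p1 poisson /(iter_threshold_kernel_bounded _ _ M _ _ s0 p0 p1)[B vB].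
rewrite /average_cost; apply: (cvg_limn_einf_sup _).2.
apply: cvg_EFin; first exact: nearW.
rewrite /comp /=.
have harm (c : R) : ((g + c * harmonic T) @[T --> \oo] --> g)%classic.
  rewrite -[X in (_ --> X)%classic]addr0; apply: cvgD; first exact: cvg_cst.
  rewrite -[X in (_ --> X)%classic](mulr0 c); apply: cvgM.
    exact: cvg_cst.
  exact: cvg_harmonic.
apply: (squeeze_cvgr _ (harm (- (`|v s0| + B))) (harm (`|v s0| + B))).
apply: nearW => T.
rewrite (expected_cost_poisson _ _ _ g _ v)//.
have -> (r r' : R) :
    (T.+1%:R * g + r - r') / T.+1%:R = g + (r - r') * harmonic T.
  by rewrite /harmonic /=; field; rewrite addrC natr1 pnatr_eq0.
have hT : 0 <= @harmonic R T by rewrite /harmonic /= invr_ge0.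
have := vB T.+1; rewrite ler_norml => /andP[? ?].
have := lexx `|v s0|; rewrite ler_norml => /andP[? ?].
by rewrite !lerD2l !ler_wpM2r//; lra.
Qed.

(* Expected cost of a cycle between resets over its expected length
   [M - 1 + 1/p]: the cycle waits [M - 1] slots and then a geometric time. *)
Definition threshold_average {R : realType} (p C : R) (M : nat) : R :=
  (M%:R * (M%:R - 1) / 2 + M%:R / p + (1 - p) / p ^+ 2 + C) / (M%:R - 1 + p^-1).

Lemma average_cost_threshold (R : realType) (p C : R) (M : nat) s0 :
  0 < p -> p <= 1 -> (0 < M)%N ->
  average_cost p C s0 (threshold_policy R M) = (threshold_average p C M)%:E.
Proof.
move=> p0 p1 M0.
set g := threshold_average p C M.
have pn0 : p != 0 by rewrite gt_eqF.
have M1 : 1 <= M%:R :> R by rewrite ler1n.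
have D0 : 0 < M%:R - 1 + p^-1 :> R by have : 0 < p^-1; [rewrite invr_gt0 | lra].
(* [H x] is the mean of [v] at age [x] with a fresh arrival indicator,
   normalized by [H 1 = 0].  Below [M] it satisfies [H x = x + 1 - g + H (x + 1)];
   above [M] the balance equation has an affine solution.  The two pieces agree
   at [M] precisely because [g] is the average cost. *)
pose lin x : R := x%:R * ((1 - p) / p) + (((1 - p) / p - g) / p + 1 + C).
pose quad x : R := (x%:R - 1) * g - (x%:R * (x%:R + 1) - 2) / 2.
pose H x : R := if (M <= x)%N then lin x else quad x.
have gE : g * (M%:R - 1 + p^-1) =
    M%:R * (M%:R - 1) / 2 + M%:R / p + (1 - p) / p ^+ 2 + C.
  by rewrite /g /threshold_average divfK// gt_eqF.
have HM : lin M = quad M.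
  rewrite /lin /quad; apply/eqP; rewrite -subr_eq0; apply/eqP.
  apply: etrans (subrr (g * (M%:R - 1 + p^-1))).
  by rewrite [X in _ = X - _]gE; field.
have H_le x : (x <= M)%N -> H x = quad x.
  rewrite /H => xM; case: leqP => // Mx.
  by have /eqP-> : x == M by rewrite eqn_leq xM.
have H1 : H 1 = 0 by rewrite H_le// /quad; lra.
pose v s : R := threshold_cost C M s - g + H (threshold_age M s).
pose A : R := `|1 + C - g| + \sum_(k < M) `|k%:R + 1 - g + H k.+1| +
  `|1 - g + lin 1| + `|(1 - p) / p + 1|.
apply: (@average_cost_poisson _ _ _ _ A _ v) => //.
- move=> s.
  have -> : threshold_kernel p M v s = H (threshold_age M s).
    rewrite /threshold_kernel; move: (threshold_age M s) => x.
    rewrite /arrival_mean /v /threshold_cost /threshold_age /threshold_action.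
    rewrite /cost /next_age /=.
    case: (leqP M x) => Mx /=.
      rewrite H1 /H Mx (leq_trans Mx (leqnSn x)) /lin -natr1; field.
      exact: pn0.
    by rewrite !H_le// 1?ltnW// /quad -[x.+1%:R]natr1; field.
  by rewrite /v; ring.
- case=> x l.
  rewrite /A; set S := \sum_(k < M) _.
  have S_ge0 : 0 <= S by exact: sumr_ge0.
  have := normr_ge0 (1 + C - g); have := normr_ge0 (1 - g + lin 1).
  have := normr_ge0 ((1 - p) / p + 1) => alpha_ge0 const_ge0 update_ge0.
  suff : `|v (x, l)| <= `|1 + C - g| + S + `|1 - g + lin 1| +
      `|(1 - p) / p + 1| * idle_age (x, l).
    have := idle_age_ge0 R (x, l); nra.
  have idle_ge0 : 0 <= `|(1 - p) / p + 1| * idle_age (x, l).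
    by rewrite mulr_ge0// idle_age_ge0.
  rewrite /v /threshold_cost /threshold_age /threshold_action.
  rewrite /cost /next_age /=.
  case: (leqP M x) => Mx /=; last first.
    rewrite !andbF /= mulr0 mul0r subr0 mulr0 addr0.
    suff : `|x%:R + 1 - g + H x.+1| <= S by lra.
    by rewrite /S (bigD1 (Ordinal Mx))//= lerDl sumr_ge0.
  case: l idle_ge0 => /= idle_ge0.
    suff -> : x%:R + 1 - x%:R * 1 * 1 + C * 1 - g + H 1 = 1 + C - g by lra.
    by rewrite H1; ring.
  rewrite /H (leq_trans Mx (leqnSn x)) /idle_age /=.
  suff -> : x%:R + 1 - x%:R * 0 * 0 + C * 0 - g + lin x.+1 =
      (1 - g + lin 1) + ((1 - p) / p + 1) * x%:R.
    apply: le_trans (ler_normD _ _) _.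
    by rewrite normrM [`|x%:R|]ger0_norm//; lra.
  by rewrite /lin -natr1; ring.
Qed.

Definition whittle_value {R : realType} (p : R) (x : nat) : R :=
  x%:R ^+ 2 / 2 - x%:R / 2 + x%:R / p.

Lemma threshold_averageE (R : realType) (p C : R) (x Y : nat) :
  0 < p -> (0 < Y)%N ->
  threshold_average p C Y = x%:R + p^-1 +
    (C - whittle_value p x + (Y%:R - x%:R) * (Y%:R - x%:R - 1) / 2) /
    (Y%:R - 1 + p^-1).
Proof.
move=> p0 Y0; rewrite /threshold_average /whittle_value; field.
have Y1 : 1 <= Y%:R :> R by rewrite ler1n.
by rewrite !gt_eqF//; nra.
Qed.

Theorem theorem7 (R : realType) (p : R) (hp0 : 0 < p) (hp1 : p <= 1)
    (s0 : state) (hs0 : (0 < s0.1)%N)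
    (x : nat) (lam : bool) (hx : (0 < x)%N) :
  is_whittle_index p s0 (x, lam)
    (if lam then x%:R ^+ 2 / 2 - x%:R / 2 + x%:R / p else 0).
Proof.
move=> C; rewrite /equally_desirable /=.
case: lam => /=; last first.
  by rewrite /cost /=; split => [|->]; lra.
rewrite -/(whittle_value p x).
have D0 (Y : nat) : (0 < Y)%N -> 0 < Y%:R - 1 + p^-1 :> R.
  move=> Y0; have : 1 <= Y%:R :> R by rewrite ler1n.
  have : 0 < p^-1 by rewrite invr_gt0.
  by lra.
split=> [[+ _ _]|->].
  rewrite !average_cost_threshold// !(threshold_averageE _ _ _ x)// => -[].
  have := lt0r_neq0 (D0 x hx); have := lt0r_neq0 (D0 x.+1 isT).
  rewrite -natr1 => D1 D2.
  move=> /addrI /eqP; rewrite eqr_div// => /eqP; lra.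
have avg_x : threshold_average p (whittle_value p x) x = x%:R + p^-1.
  by rewrite (threshold_averageE _ _ _ x)// !(subrr, mul0r, addr0).
have avg_x1 : threshold_average p (whittle_value p x) x.+1 = x%:R + p^-1.
  rewrite (threshold_averageE _ _ _ x)// -natr1.
  suff -> : x%:R + 1 - x%:R - 1 = 0 :> R.
    by rewrite mulr0 !(subrr, mul0r, addr0).
  by ring.
have avg_ge Y : (0 < Y)%N ->
    x%:R + p^-1 <= threshold_average p (whittle_value p x) Y.
  move=> Y0; rewrite (threshold_averageE _ _ _ x)// lerDl.
  apply: divr_ge0; last exact/ltW/D0.
  rewrite subrr add0r divr_ge0//.
  have [Yx|xY] := leqP Y x.
    have : Y%:R <= x%:R :> R by rewrite ler_nat.
    by move=> ?; nra.
  have : x.+1%:R <= Y%:R :> R by rewrite ler_nat.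
  by rewrite -natr1 => ?; nra.
by split=> [|Y Y0|Y Y0]; rewrite !average_cost_threshold// ?lee_fin
  ?avg_x ?avg_x1//; exact: avg_ge.
Qed.
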